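(* Let $\mathscr{H},\mathscr{K}$ be Hilbert spaces and let $m<M$ be real numbers. Let $A_1,\ldots,A_n\in\mathbb{B}(\mathscr{H})$ be self-adjoint operators with spectra in $[m,M]$, and let $\Phi_1,\ldots,\Phi_n:\mathbb{B}(\mathscr{H})\to\mathbb{B}(\mathscr{K})$ be positive linear maps with $\sum_{i=1}^n\Phi_i(\mathbf{1}_{\mathscr{H}})=\mathbf{1}_{\mathscr{K}}$. Let $f:[m,M]\to\mathbb{R}$ be a continuous twice differentiable function such that $\alpha\le f''\le\beta$ on $[m,M]$, where $\alpha,\beta\in\mathbb{R}$. Put $$J:=(M+m)\sum_{i=1}^n\Phi_i(A_i)-Mm\,\mathbf{1}_{\mathscr{K}}-\frac12\left(\left(\sum_{i=1}^n\Phi_i(A_i)\right)^2+\sum_{i=1}^n\Phi_i(A_i^2)\right).$$ Then $J\ge 0$ and $$\left(f(M)+f(m)\right)\mathbf{1}_{\mathscr{K}}-\sum_{i=1}^n\Phi_i(f(A_i))-\beta J\;\le\; f\left((M+m)\mathbf{1}_{\mathscr{K}}-\sum_{i=1}^n\Phi_i(A_i)\right)\;\le\;\left(f(M)+f(m)\right)\mathbf{1}_{\mathscr{K}}-\sum_{i=1}^n\Phi_i(f(A_i))-\alpha J.$$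
   Context: $\mathbb{B}(\mathscr{H})$ is the $C^*$-algebra of all bounded linear operators on the Hilbert space $\mathscr{H}$, and $\mathbf{1}_{\mathscr{H}}$ is the identity operator. $A\ge 0$ means $\langle Ax,x\rangle\ge 0$ for all $x$; for self-adjoint $A,B$, $A\le B$ means $B-A\ge 0$. A linear map $\Phi:\mathbb{B}(\mathscr{H})\to\mathbb{B}(\mathscr{K})$ is positive if $\Phi(A)\ge 0$ whenever $A\ge 0$. For a self-adjoint operator $A$, $f(A)$ is defined by the functional calculus. *)

(* Defs.v *)
From HB Require Import structures.
From mathcomp Require Import all_boot all_order all_algebra.
From mathcomp Require Export complex.
From mathcomp Require Import all_classical all_reals all_analysis.

Set Implicit Arguments.
Unset Strict Implicit.
Unset Printing Implicit Defensive.

Import Order.TTheory GRing.Theory Num.Theory.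
Import numFieldNormedType.Exports.

Local Open Scope classical_set_scope.
Local Open Scope ring_scope.
Local Open Scope complex_scope.

(* Complex Hilbert spaces; the inner product is linear in its first argument. *)
HB.mixin Record CompleteNormedModule_isHilbert (R : realType) (H : Type)
    of CompleteNormedModule R[i] H := {
  inner : {dot H for (@Num.conj R[i])};
  normr_inner : forall x : H, `|x| ^+ 2 = inner x x
}.

#[short(type="hilbertType")]
HB.structure Definition Hilbert (R : realType) :=
  {H of CompleteNormedModule R[i] H & CompleteNormedModule_isHilbert R H}.

Definition bounded_linear (R : realType) (H : hilbertType R) (A : H -> H) : Prop :=
  linear A /\ exists k : R, forall x, `|A x| <= k%:C * `|x|.

Record bounded_operator (R : realType) (H : hilbertType R) := BoundedOperator {
  operator_fun :> H -> H;
  operator_funP : `[< bounded_linear operator_fun >]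
}.

Notation "''B' ( H )" := (bounded_operator H)
  (at level 8, format "''B' ( H )") : type_scope.

Section BoundedOperators.
Variables (R : realType) (H : hilbertType R).
Implicit Types A B C : 'B(H).

HB.instance Definition _ := [isSub for @operator_fun R H].
HB.instance Definition _ := [Choice of 'B(H) by <:].

Lemma operator_linear A : linear A.
Proof. by case: A => f fP /=; case: (asboolW fP). Qed.

Lemma operator_bounded A : exists k : R, forall x, `|A x| <= k%:C * `|x|.
Proof. by case: A => f fP /=; case: (asboolW fP). Qed.

HB.instance Definition _ A :=
  GRing.isLinear.Build R[i] H H _ (operator_fun A) (operator_linear A).

Lemma operator_eqP A B : A =1 B -> A = B.
Proof. by move=> AB; apply/val_inj/funext. Qed.

Let bounded_pred : {pred H -> H} := fun u => `[< bounded_linear u >].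

Lemma bounded_linear_submod : GRing.submod_closed bounded_pred.
Proof.
split.
  apply/asboolP; split; first by move=> a x y /=; rewrite scaler0 addr0.
  by exists 0 => x; rewrite mul0r normr0.
move=> a f g /asboolW[fl [k fk]] /asboolW[gl [l gl']]; apply/asboolP; split.
  move=> b x y; rewrite -[RHS]/(b *: (a *: f x + g x) + (a *: f y + g y)).
  rewrite -[LHS]/(a *: f (b *: x + y) + g (b *: x + y)) fl gl.
  by rewrite !scalerDr !scalerA mulrC addrACA.
exists (complex.Re `|a| * k + l) => x.
have aE : (complex.Re `|a|)%:C = `|a| by case: a.
apply: (le_trans (ler_normD (a *: f x) (g x))).
rewrite rmorphD rmorphM /= aE mulrDl lerD // normrZ -mulrA.
by rewrite ler_wpM2l.
Qed.

HB.instance Definition _ := GRing.SubChoice_isSubLmodule.Build R[i] (H -> H)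
  bounded_pred 'B(H) (GRing.submod_closed_semi bounded_linear_submod).

Lemma bounded_linear_id : `[< bounded_linear (@id H) >].
Proof. by apply/asboolP; split=> //; exists 1 => x; rewrite mul1r. Qed.

Lemma bounded_linear_comp A B : `[< bounded_linear (A \o B) >].
Proof.
apply/asboolP; split; first by move=> a x y /=; rewrite !linearP.
have [k Ak] := operator_bounded A; have [l Bl] := operator_bounded B.
exists (`|k| * `|l|) => x; rewrite /= rmorphM -mulrA.
have kx (y : R) (z : H) : y%:C * `|z| <= `|y|%:C * `|z|.
  by rewrite ler_wpM2r// lecR ler_norm.
apply: (le_trans (Ak _)); apply: (le_trans (kx _ _)).
rewrite ler_wpM2l ?lecR//.
by apply: (le_trans (Bl _)); exact: kx.
Qed.

Definition operator_one : 'B(H) := BoundedOperator bounded_linear_id.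
Definition operator_mul A B : 'B(H) := BoundedOperator (bounded_linear_comp A B).

Let mulA : associative operator_mul.
Proof. by move=> A B C; exact: operator_eqP. Qed.
Let mul1 : left_id operator_one operator_mul.
Proof. by move=> A; exact: operator_eqP. Qed.
Let mulr1' : right_id operator_one operator_mul.
Proof. by move=> A; exact: operator_eqP. Qed.
Let mulDl : left_distributive operator_mul +%R.
Proof. by move=> A B C; exact: operator_eqP. Qed.
Let mulDr : right_distributive operator_mul +%R.
Proof. by move=> A B C; apply: operator_eqP => x /=; exact: linearD. Qed.

(* Possibly trivial, since H may be the zero space. *)
HB.instance Definition _ := GRing.Zmodule_isPzRing.Build 'B(H)
  mulA mul1 mulr1' mulDl mulDr.

End BoundedOperators.

Section OperatorTheory.
Variables (R : realType) (H : hilbertType R).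
Implicit Types A B : 'B(H).

Definition self_adjoint A : Prop :=
  forall x y, inner (A x) y = inner x (A y).

(* On R[i], 0 <= z means that z is real and nonnegative. *)
Definition operator_ge0 A : Prop := forall x, 0 <= inner (A x) x.

Definition operator_le A B : Prop := operator_ge0 (B - A).

Definition spectrum A : set R[i] :=
  [set l | ~ exists B : 'B(H), B * (A - l *: (1 : 'B(H))) = 1 /\ (A - l *: (1 : 'B(H))) * B = 1].

Definition real_spectrum A : set R := [set t | spectrum A t%:C].

Definition spectrum_in A (D : set R) : Prop :=
  spectrum A `<=` [set t%:C | t in D].

Definition operator_cvg (U : nat -> 'B(H)) A : Prop :=
  forall e : R, 0 < e ->
    \forall k \near \oo, forall x, `|(U k - A) x| <= e%:C * `|x|.

Definition poly_operator (p : {poly R}) A : 'B(H) :=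
  \sum_(k < size p) (p`_k)%:C *: A ^+ k.

(* B = f(A): f is a uniform limit on the spectrum of A of real polynomials p_k
   such that p_k(A) tends to B in operator norm. *)
Definition is_cfc (f : R -> R) A B : Prop :=
  exists p : nat -> {poly R},
    (forall e : R, 0 < e -> \forall k \near \oo,
       forall t, real_spectrum A t -> `|(p k).[t] - f t| <= e) /\
    operator_cvg (fun k => poly_operator (p k) A) B.

(* Continuous functional calculus, for A self-adjoint and f continuous on the
   spectrum of A; the value is the default 0 if no B satisfies is_cfc. *)
Definition cfc (f : R -> R) A : 'B(H) := xget 0 (is_cfc f A).

End OperatorTheory.

Definition positive_map (R : realType) (H K : hilbertType R)
    (Phi : 'B(H) -> 'B(K)) : Prop :=
  forall A : 'B(H), operator_ge0 A -> operator_ge0 (Phi A).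

(* Derivative relative to D, hence one-sided at the endpoints of an interval. *)
Definition has_derivative_on (R : realType) (D : set R) (f f' : R -> R) : Prop :=
  forall x, D x ->
    (fun y => (f y - f x) / (y - x)) @ within D x^' --> f' x.

(* Main.v *)
(** Put S = sum Phi_i(A_i), V = sum Phi_i(A_i^2) and T = (M + m) - S. For a quadratic
    polynomial q with leading coefficient gamma / 2, a direct computation gives
      q(T) + sum Phi_i(q(A_i)) = q(M) + q(m) - gamma J.
    With q(t) = (M - t)(t - m), for which gamma = -2, the left-hand side is
    nonnegative, hence J >= 0. If f'' >= alpha, let q be the quadratic polynomial
    with q'' = alpha that interpolates f at m and M: f - q is convex and vanishes
    at m and M, so f <= q on [m, M], whence f(T) <= q(T) and f(A_i) <= q(A_i), and
    the upper bound follows. The lower bound is the same argument for -f and beta.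

    Comparing f(A) with q(A) only needs that p(A) >= 0 for a real polynomial p that
    is nonnegative on the spectrum of A (spectral mapping, together with the fact
    that the bottom of the numerical range of a self-adjoint operator belongs to its
    spectrum). The same fact bounds the norm of p(A), so that the Bernstein
    polynomials of f, evaluated at A, converge to f(A). *)

Require Import Defs.
From HB Require Import structures.
From mathcomp Require Import all_boot all_order all_algebra.
From mathcomp Require Import all_classical all_reals all_analysis.
From mathcomp Require Import ring lra.
Import Order.TTheory GRing.Theory Num.Theory.
Import numFieldNormedType.Exports.

Local Open Scope classical_set_scope.
Local Open Scope ring_scope.
Local Open Scope complex_scope.

Set Implicit Arguments.
Unset Strict Implicit.
Unset Printing Implicit Defensive.

(** The value at [(c, -b)] is [c * (a * c - b ^+ 2)], which settles [0 < c]; if [c = 0], the value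
    at [(b, -(a + 1))] is nonnegative only when [b = 0]. *)
Lemma discriminant_le (R : realFieldType) (a b c : R) :
  (forall s t, 0 <= s ^+ 2 * a + s * t * b *+ 2 + t ^+ 2 * c) -> b ^+ 2 <= a * c.
Proof.
move=> h.
have a0 : 0 <= a by have := h 1 0; lra.
have c0 : 0 <= c by have := h 0 1; lra.
have [c_gt0|] := ltP 0 c.
  have := h c (- b); rewrite (_ : _ + _ = c * (a * c - b ^+ 2)); last by ring.
  by rewrite pmulr_rge0// subr_ge0.
move=> c_le0; have c00 : c = 0 by apply/eqP; rewrite eq_le c_le0.
have b20 : 0 <= b ^+ 2 by exact: sqr_ge0.
have := h b (- (a + 1)).
have : 0 <= a * b ^+ 2 by rewrite mulr_ge0.
rewrite c00 !mulr0 addr0; set d := a * _.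
rewrite (_ : _ + _ = - d - b ^+ 2 *+ 2); last by rewrite /d; ring.
lra.
Qed.

(** * Real inner product and real norm of a complex Hilbert space *)

Section HilbertSpace.
Variables (R : realType) (H : hilbertType R).
Implicit Types (x y z : H) (a : R).

(** Inner products and norms are valued in [R[i]]; taking real parts moves the estimates to the
    ordered field [R]. *)
Definition ip x y : R := complex.Re (inner x y).
Definition nrm x : R := complex.Re `|x|.

Lemma nrmE x : `|x| = (nrm x)%:C.
Proof. by rewrite /nrm RRe_real// normr_real. Qed.

Lemma nrm_ge0 x : 0 <= nrm x.
Proof. by have := normr_ge0 x; rewrite nrmE lecE => /andP[]. Qed.

Lemma innerC x y : inner x y = (inner y x)^*%C.
Proof. by rewrite (hermC (inner : {dot H for _}) x y) expr0 mul1r. Qed.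

Lemma innerDl x y z : inner (x + y) z = inner x z + inner y z.
Proof. exact: linearDl. Qed.

Lemma innerDr x y z : inner z (x + y) = inner z x + inner z y.
Proof. exact: linearDr. Qed.

Lemma innerNl x y : inner (- x) y = - inner x y.
Proof. exact: linearNl. Qed.

Lemma innerNr x y : inner x (- y) = - inner x y.
Proof. exact: linearNr. Qed.

Lemma innerZl (c : R[i]) x y : inner (c *: x) y = c * inner x y.
Proof. exact: linearZl_LR. Qed.

Lemma innerZr (c : R[i]) x y : inner x (c *: y) = c^*%C * inner x y.
Proof. exact: linearZr_LR. Qed.

Lemma ipC x y : ip x y = ip y x.
Proof. by rewrite /ip innerC; case: (inner y x). Qed.

Lemma ipDl x y z : ip (x + y) z = ip x z + ip y z.
Proof. by rewrite /ip innerDl raddfD. Qed.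

Lemma ipZl a x y : ip (a%:C *: x) y = a * ip x y.
Proof. by rewrite /ip innerZl; case: (inner x y) => u v /=; rewrite mul0r subr0. Qed.

Lemma ipNl x y : ip (- x) y = - ip x y.
Proof. by rewrite /ip innerNl raddfN. Qed.

Lemma ipBl x y z : ip (x - y) z = ip x z - ip y z.
Proof. by rewrite ipDl ipNl. Qed.

Lemma ipDr x y z : ip z (x + y) = ip z x + ip z y.
Proof. by rewrite ipC ipDl !(ipC z). Qed.

Lemma ipZr a x y : ip y (a%:C *: x) = a * ip y x.
Proof. by rewrite ipC ipZl (ipC y). Qed.

Lemma ipNr x y : ip y (- x) = - ip y x.
Proof. by rewrite ipC ipNl (ipC y). Qed.

Lemma ip0l x : ip 0 x = 0.
Proof. by rewrite /ip linear0l. Qed.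

Lemma ipxx x : ip x x = nrm x ^+ 2.
Proof. by rewrite /ip -normr_inner nrmE -rmorphXn. Qed.

Lemma innerxx x : inner x x = (nrm x ^+ 2)%:C.
Proof. by rewrite -normr_inner nrmE -rmorphXn. Qed.

Lemma nrm_eq0 x : nrm x = 0 -> x = 0.
Proof. by move=> x0; apply/eqP; rewrite -normr_eq0 nrmE x0. Qed.

Lemma nrmZ a x : nrm (a%:C *: x) = `|a| * nrm x.
Proof. by rewrite /nrm normrZ nrmE normc_def /= expr0n /= addr0 sqrtr_sqr mul0r subr0. Qed.

Lemma nrmD x y : nrm (x + y) <= nrm x + nrm y.
Proof. by rewrite -lecR rmorphD /= -!nrmE; exact: ler_normD. Qed.

Lemma nrmN x : nrm (- x) = nrm x.
Proof. by rewrite /nrm normrN. Qed.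

Lemma nrm0 : nrm 0 = 0.
Proof. by rewrite /nrm normr0. Qed.

Lemma le_nrm (k : R) x y : (`|x| <= k%:C * `|y|) = (nrm x <= k * nrm y).
Proof. by rewrite !nrmE -rmorphM /= lecR. Qed.

End HilbertSpace.

(** * Self-adjoint and positive operators *)

Section Operators.
Variables (R : realType) (H : hilbertType R).
Implicit Types (x y z : H) (a : R) (A B C : 'B(H)).

Lemma opD A B x : (A + B) x = A x + B x. Proof. by []. Qed.
Lemma opN A x : (- A) x = - A x. Proof. by []. Qed.
Lemma opB A B x : (A - B) x = A x - B x. Proof. by []. Qed.
Lemma opZ (c : R[i]) A x : (c *: A) x = c *: A x. Proof. by []. Qed.
Lemma opM A B x : (A * B) x = A (B x). Proof. by []. Qed.
Lemma op1 x : (1 : 'B(H)) x = x. Proof. by []. Qed.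
Lemma op0 x : (0 : 'B(H)) x = 0. Proof. by []. Qed.
Lemma opAD A x y : A (x + y) = A x + A y. Proof. exact: linearD. Qed.
Lemma opAZ A c x : A (c *: x) = c *: A x. Proof. exact: linearZ. Qed.
Lemma opAN A x : A (- x) = - A x. Proof. exact: linearN. Qed.
Lemma opAB A x y : A (x - y) = A x - A y. Proof. exact: linearB. Qed.

Definition opE := (opD, opN, opZ, opM, op1, op0).

Lemma opZAl (c : R[i]) A B : c *: A * B = c *: (A * B).
Proof. exact: operator_eqP. Qed.

Lemma opZAr (c : R[i]) A B : A * (c *: B) = c *: (A * B).
Proof. by apply: operator_eqP => x; rewrite !opE linearZ. Qed.

Lemma operator_bounded_nrm A : exists2 k : R, 0 <= k & forall x, nrm (A x) <= k * nrm x.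
Proof.
have [k hk] := operator_bounded A; exists `|k| => // x.
move: (hk x); rewrite le_nrm => /le_trans; apply.
by rewrite ler_wpM2r ?nrm_ge0// ler_norm.
Qed.

Lemma ip_sa A x y : self_adjoint A -> ip (A x) y = ip x (A y).
Proof. by move=> Asa; rewrite /ip Asa. Qed.

Lemma op_ge0_ip A x : operator_ge0 A -> 0 <= ip (A x) x.
Proof. by move=> /(_ x); rewrite lecE => /andP[]. Qed.

Lemma ip_op_ge0 A : self_adjoint A -> (forall x, 0 <= ip (A x) x) -> operator_ge0 A.
Proof.
move=> Asa A0 x; rewrite lecE A0 andbT /=.
have : inner (A x) x = (inner (A x) x)^*%C by rewrite -innerC -Asa.
by case: (inner (A x) x) => u v [] /= ?; apply/eqP; lra.
Qed.

(** Polarization: [phi] vanishes on the diagonal, hence is antisymmetric; replacing [x] by ['i *: x]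
    shows that it is also symmetric, hence zero. *)
Lemma op_ge0_sa A : operator_ge0 A -> self_adjoint A.
Proof.
move=> A0.
pose phi x y : R[i] := inner (A x) y - inner x (A y).
have phixx x : phi x x = 0.
  rewrite /phi (innerC x); apply/eqP; rewrite subr_eq0; apply/eqP.
  by have := A0 x; case: (inner (A x) x) => u v; rewrite lecE /= => /andP[/eqP -> _]; rewrite oppr0.
have phiD x y : phi (x + y) (x + y) = phi x x + phi x y + (phi y x + phi y y).
  by rewrite /phi opAD !innerDl !innerDr; ring.
have phis x y : phi x y + phi y x = 0.
  by have := phiD x y; rewrite !phixx add0r addr0.
have phiZl x y : phi ('i *: x) y = 'i * phi x y.
  by rewrite /phi linearZ /= !innerZl mulrBr.
have phiZr x y : phi y ('i *: x) = - ('i * phi y x).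
  by rewrite /phi opAZ !innerZr -[_^*%C]/('i^*)%R conjCi; ring.
move=> x y; apply/eqP; rewrite -subr_eq0; apply/eqP; rewrite -/(phi x y).
have := phis ('i *: x) y; rewrite phiZl phiZr -mulrBr => /eqP.
rewrite mulf_eq0 (negbTE (neq0Ci _)) /= => /eqP h.
have := phis x y; have -> : phi y x = phi x y by apply/eqP; rewrite eq_sym -subr_eq0 h.
move=> /eqP; rewrite -mulr2n mulrn_eq0 /= => /eqP //.
Qed.

(** The imaginary part of [inner u v] is [ip u ('i *: v)], so the real form determines the complex
    one. *)
Lemma ip_symmetric_sa A : (forall x y, ip (A x) y = ip x (A y)) -> self_adjoint A.
Proof.
move=> hA x y; have ImE u v : complex.Im (inner u v) = ip u ('i%C *: v).
  by rewrite /ip innerZr; case: (inner u v) => a b /=; rewrite mul0r mulN1r opprK add0r.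
apply/eqP; rewrite eq_complex -![complex.Re _]/(ip _ _) !ImE hA eqxx /=.
by rewrite hA opAZ.
Qed.

Lemma sa0 : self_adjoint (0 : 'B(H)).
Proof. by move=> x y; rewrite !op0 linear0l linear0r. Qed.

Lemma sa1 : self_adjoint (1 : 'B(H)).
Proof. by []. Qed.

Lemma saD A B : self_adjoint A -> self_adjoint B -> self_adjoint (A + B).
Proof. by move=> sA sB x y; rewrite !opD innerDl innerDr sA sB. Qed.

Lemma saZ a A : self_adjoint A -> self_adjoint (a%:C *: A).
Proof.
move=> sA x y; rewrite !opZ innerZl innerZr sA; congr (_ * _).
by rewrite /= oppr0.
Qed.

Lemma saN A : self_adjoint A -> self_adjoint (- A).
Proof. by move=> sA x y; rewrite !opN innerNl innerNr sA. Qed.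

Lemma saB A B : self_adjoint A -> self_adjoint B -> self_adjoint (A - B).
Proof. by move=> sA sB; apply: saD => //; apply: saN. Qed.

Lemma sa_scalar a : self_adjoint (a%:C *: (1 : 'B(H))).
Proof. exact/saZ/sa1. Qed.

Lemma sa_comm A B : self_adjoint A -> self_adjoint B -> A * B = B * A ->
  self_adjoint (A * B).
Proof. by move=> sA sB AB x y; rewrite AB !opM sB sA -opM AB. Qed.

Lemma saX A k : self_adjoint A -> self_adjoint (A ^+ k).
Proof.
move=> sA; elim: k => [|k IH]; first exact: sa1.
by rewrite exprS; apply: sa_comm => //; rewrite -exprS exprSr.
Qed.

Lemma sa_sum (I : Type) (r : seq I) (P : pred I) (F : I -> 'B(H)) :
  (forall i, P i -> self_adjoint (F i)) -> self_adjoint (\sum_(i <- r | P i) F i).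
Proof. by move=> sF; elim/big_ind: _ => //; [exact: sa0 | exact: saD]. Qed.

Lemma op_ge0D A B : operator_ge0 A -> operator_ge0 B -> operator_ge0 (A + B).
Proof. by move=> A0 B0 x; rewrite opD innerDl addr_ge0// ?A0 ?B0. Qed.

Lemma op_ge0_sum (I : Type) (r : seq I) (P : pred I) (F : I -> 'B(H)) :
  (forall i, P i -> operator_ge0 (F i)) -> operator_ge0 (\sum_(i <- r | P i) F i).
Proof.
move=> sF; elim/big_ind: _ => //; [|exact: op_ge0D].
by move=> x; rewrite op0 linear0l.
Qed.

Lemma sa_cauchy_schwarz A x y : self_adjoint A -> (forall z, 0 <= ip (A z) z) ->
  ip (A x) y ^+ 2 <= ip (A x) x * ip (A y) y.
Proof.
move=> sA A0; apply: discriminant_le => s t.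
have := A0 (s%:C *: x + t%:C *: y).
rewrite linearD !linearZ /= !(ipDl, ipDr, ipZl, ipZr) (ip_sa y x sA) (ipC y).
by congr (_ <= _); ring.
Qed.

Lemma ip_cauchy_schwarz x y : ip x y <= nrm x * nrm y.
Proof.
have := @sa_cauchy_schwarz 1 x y sa1.
rewrite !op1 !ipxx -exprMn => /(_ (fun z => _)) h.
apply: (le_trans (ler_norm _)); rewrite -(@ler_pXn2r _ 2)// ?nnegrE ?mulr_ge0 ?nrm_ge0//.
rewrite real_normK ?num_real//; apply: h => z.
by rewrite op1 ipxx sqr_ge0.
Qed.

(* Cauchy-Schwarz for the form of [A] at [x] and [A x]. *)
Lemma nrm_op_sqr_le A (c : R) x : self_adjoint A ->
  (forall z, 0 <= ip (A z) z) -> (forall z, ip (A z) z <= c * nrm z ^+ 2) ->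
  nrm (A x) ^+ 2 <= c * ip (A x) x.
Proof.
move=> sA A0 Ac; have := sa_cauchy_schwarz x (A x) sA A0; rewrite ipxx => h.
have [->|nz] := eqVneq (nrm (A x)) 0.
  (* A negative [c] is allowed: the two bounds then force the form of [A] to vanish at [x]. *)
  rewrite expr0n /=; have [c0|c0] := leP 0 c; first by rewrite mulr_ge0.
  have : ip (A x) x = 0; last by move=> ->; rewrite mulr0.
  apply/eqP; rewrite eq_le A0 andbT (le_trans (Ac x))//.
  by rewrite nmulr_rle0// sqr_ge0.
have n0 : 0 < nrm (A x) ^+ 2 by rewrite exprn_gt0// lt_def nz nrm_ge0.
rewrite -(ler_pM2r n0) -expr2 (le_trans h)// mulrC [leRHS]mulrAC ler_wpM2r//.
Qed.

Lemma nrm_op_le A (c : R) x : self_adjoint A -> 0 <= c ->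
  (forall z, 0 <= ip (A z) z) -> (forall z, ip (A z) z <= c * nrm z ^+ 2) ->
  nrm (A x) <= c * nrm x.
Proof.
move=> sA c0 A0 Ac; rewrite -(@ler_pXn2r _ 2)// ?nnegrE ?mulr_ge0 ?nrm_ge0//.
by rewrite (le_trans (nrm_op_sqr_le x sA A0 Ac))// exprMn expr2 -mulrA ler_wpM2l.
Qed.

End Operators.

(** * Limits of powers, vectors and operators *)

Lemma exists_expr_le (R : realType) (r e : R) : 0 <= r < 1 -> 0 < e ->
  exists N, forall k, (N <= k)%N -> r ^+ k <= e.
Proof.
move=> /andP[r0 r1] e0.
have /cvg_expr : `|r| < 1 by rewrite ger0_norm.
move=> /cvgrPdist_le /(_ e e0)[N _ hN]; exists N => k Nk.
have := hN k Nk; rewrite /= sub0r normrN ger0_norm//.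
by rewrite exprn_ge0.
Qed.

Lemma gt0_complexE (R : rcfType) (z : R[i]) : 0 < z -> exists2 r : R, 0 < r & z = r%:C.
Proof. by case: z => a b; rewrite ltcE /= => /andP[/eqP -> a0]; exists a. Qed.

Section Limits.
Variables (R : realType) (H : hilbertType R).
Implicit Types (x y z : H) (a : R) (A B C : 'B(H)).

Lemma operator_cvgP (U : nat -> 'B(H)) A : operator_cvg U A <->
  (forall e : R, 0 < e -> exists N, forall k, (N <= k)%N ->
     forall x, nrm (U k x - A x) <= e * nrm x).
Proof.
split=> h e e0; have := h e e0.
  move=> [N _ hN]; exists N => k Nk x.
  by have := hN k Nk x; rewrite le_nrm.
move=> [N hN]; exists N => // k /= Nk x.
by rewrite le_nrm; apply: hN.
Qed.

Lemma cvg_nrmP (u : nat -> H) x : u @ \oo --> x <->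
  (forall e : R, 0 < e -> exists N, forall k, (N <= k)%N -> nrm (x - u k) <= e).
Proof.
split.
  move=> /cvgrPdist_le h e e0.
  have [N _ hN] : \forall k \near \oo, `|x - u k| <= e%:C by apply: h; rewrite ltcR.
  by exists N => k Nk; have := hN k Nk; rewrite /= nrmE lecR.
move=> h; apply/cvgrPdist_le => _ /gt0_complexE[e e0 ->].
have [N hN] := h _ e0; exists N => // k /= Nk.
by rewrite nrmE lecR hN.
Qed.

(** Pointwise limits exist because [H] is complete; as the Cauchy bound is uniform in [x], it passes
    to the limit, which makes the convergence uniform and the limit bounded. *)
Lemma operator_cauchy_cvg (U : nat -> 'B(H)) :
  (forall e : R, 0 < e -> exists N, forall k l, (N <= k)%N -> (N <= l)%N ->
     forall x, nrm (U k x - U l x) <= e * nrm x) ->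
  exists B, operator_cvg U B.
Proof.
move=> hU.
have cvgU x : exists y, (fun k => U k x) @ \oo --> y.
  suff : cvg ((fun k => U k x) @ \oo) by move=> /cvg_ex.
  apply: cauchy_cvg; apply: cauchy_exP => _ /gt0_complexE[e e0 ->].
  (* The summand 1 covers [x = 0] and makes the estimate strict. *)
  have n1 : 0 < nrm x + 1 by rewrite ltr_wpDl ?nrm_ge0.
  have [|N hN] := hU (e / 2 / (nrm x + 1)); first by rewrite !divr_gt0.
  exists (U N x); exists N => // k /= Nk.
  rewrite -ball_normE /= nrmE ltcR.
  apply: le_lt_trans (hN _ _ (leqnn N) Nk x) _.
  rewrite mulrAC ltr_pdivrMr// -mulrA ltr_pM2l//.
  have := nrm_ge0 x; lra.
have [B hB] := choice cvgU.
have unif e : 0 < e -> exists N, forall k, (N <= k)%N ->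
    forall x, nrm (U k x - B x) <= e * nrm x.
  move=> e0; have [N hN] := hU e e0; exists N => k Nk x.
  apply/ler_addgt0Pr => d d0; have /cvg_nrmP /(_ d d0)[N' hN'] := hB x.
  have -> : U k x - B x = (U k x - U (maxn N N') x) - (B x - U (maxn N N') x).
    by rewrite opprB addrA subrK.
  apply: (le_trans (nrmD _ _)); rewrite nrmN lerD//.
    by apply: hN => //; exact: leq_maxl.
  by apply: hN'; exact: leq_maxr.
have Blin : linear B.
  move=> a x y; apply: (cvg_unique _ (hB (a *: x + y))); first exact: norm_hausdorff.
  rewrite [X in X @ _](_ : _ = (fun k => a *: U k x + U k y)); last first.
    by apply/funext => k; rewrite opAD opAZ.
  by apply: cvgD => //; apply: cvgZ => //; exact: cvg_cst.
have Bbound : exists k : R, forall x, `|B x| <= k%:C * `|x|.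
  have [N hN] := unif 1 ltr01; have [c c0 hc] := operator_bounded_nrm (U N).
  exists (c + 1) => x; rewrite le_nrm mulrDl.
  have -> : B x = U N x - (U N x - B x) by rewrite opprB addrC subrK.
  by apply: (le_trans (nrmD _ _)); rewrite nrmN lerD// hN.
have Bop : `[< bounded_linear B >] by apply/asboolP.
by exists (BoundedOperator Bop); apply/operator_cvgP.
Qed.

End Limits.

(** * Invertibility, spectrum and numerical range *)

Section Invertibility.
Variables (R : realType) (H : hilbertType R).
Implicit Types (x y z : H) (a : R) (A B C T : 'B(H)).

Definition op_invertible A := exists B, B * A = 1 /\ A * B = 1.

Lemma op_invertibleM A B : op_invertible A -> op_invertible B -> op_invertible (A * B).
Proof.
move=> [A' [A'A AA']] [B' [B'B BB']]; exists (B' * A'); split.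
  by rewrite mulrA -(mulrA B') A'A mulr1.
by rewrite mulrA -(mulrA A) BB' mulr1.
Qed.

Lemma op_invertibleZ (c : R[i]) A : c != 0 -> op_invertible A -> op_invertible (c *: A).
Proof.
move=> c0 [B [BA AB]]; exists (c^-1 *: B).
by rewrite !opZAl !opZAr !scalerA BA AB divff// mulVf// scale1r.
Qed.

(** If [C] inverts the product, [B * C] is a right inverse of [A] and, by commutation, [C * B] is a
    left inverse; the two then coincide. *)
Lemma op_invertible_factor A B : A * B = B * A -> op_invertible (A * B) -> op_invertible A.
Proof.
move=> AB [C [CAB ABC]]; exists (C * B).
have : A * (B * C) = 1 by rewrite mulrA.
have CBA : C * B * A = 1 by rewrite -mulrA -AB.
move=> ABC1; split => //.
have -> // : C * B = B * C by rewrite -[LHS]mulr1 -ABC1 mulrA CBA mul1r.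
Qed.

Lemma le_nrm_coercive A (d : R) x : 0 <= d ->
  (forall x, d * nrm x ^+ 2 <= ip (A x) x) -> d * nrm x <= nrm (A x).
Proof.
move=> d0 hd; have [->|nz] := eqVneq (nrm x) 0; first by rewrite mulr0 nrm_ge0.
have n0 : 0 < nrm x by rewrite lt_def nz nrm_ge0.
rewrite -(ler_pM2r n0); apply: le_trans (ip_cauchy_schwarz _ _).
by rewrite -mulrA -expr2.
Qed.

(* Neumann series: with N = 1 - P / c, the partial sums U k of the powers of N
   satisfy P (U k - U l) = c (N^l - N^k), and P is bounded below. *)
Lemma coercive_invertible P (d : R) : self_adjoint P -> 0 < d ->
  (forall x, d * nrm x ^+ 2 <= ip (P x) x) -> op_invertible P.
Proof.
move=> sP d0 hd; have [k k0 hk] := operator_bounded_nrm P.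
(* As [c] exceeds the bound [k] on the norm of [P], the form of [N] is nonnegative; coercivity
   bounds it above by [r = 1 - d / c]. Adding [d] also gives [d / c <= 1]. *)
pose c := k + d; have c0 : 0 < c by rewrite ltr_wpDl.
pose N : 'B(H) := 1 - (c^-1)%:C *: P; pose r := 1 - d / c.
have r01 : 0 <= r < 1.
  by rewrite subr_ge0 ler_pdivrMr// mul1r lerDr k0 /= gtrBl divr_gt0.
have /andP[r0 r1] := r01.
have sN : self_adjoint N by apply: saB; [exact: sa1 | exact: saZ].
have ipN x : ip (N x) x = nrm x ^+ 2 - c^-1 * ip (P x) x.
  by rewrite !opE ipBl ipxx ipZl.
have N_ge0 x : 0 <= ip (N x) x.
  rewrite ipN subr_ge0 ler_pdivrMl//.
  apply: le_trans (ip_cauchy_schwarz _ _) _.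
  rewrite expr2 mulrA ler_wpM2r ?nrm_ge0// (le_trans (hk x))//.
  by rewrite ler_wpM2r ?nrm_ge0// lerDl ltW.
have N_le x : ip (N x) x <= r * nrm x ^+ 2.
  rewrite ipN mulrBl mul1r lerB// mulrAC [leLHS]mulrC ler_wpM2l//.
  by rewrite invr_ge0 ltW.
have nrmN1 x : nrm (N x) <= r * nrm x by exact: nrm_op_le.
have nrmNX j x : nrm ((N ^+ j) x) <= r ^+ j * nrm x.
  elim: j => [|j IH]; first by rewrite expr0 mul1r.
  by rewrite !exprS opM (le_trans (nrmN1 _))// -mulrA ler_wpM2l.
pose U j : 'B(H) := \sum_(i < j) N ^+ i.
have PU j : P * U j = c%:C *: (1 - N ^+ j).
  have := subrX1 N j; rewrite -/(U j) => h.
  have -> : P = c%:C *: (1 - N).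
    by rewrite /N opprB addrC subrK scalerA -rmorphM /= divff ?gt_eqF// scale1r.
  by rewrite opZAl -[1 - N]opprB mulNr -h opprB.
have Pbelow x : d * nrm x <= nrm (P x) by apply: le_nrm_coercive => //; exact: ltW.
have [e e0|B /operator_cvgP hB] := @operator_cauchy_cvg _ _ U.
  (* Two powers of [N], each at most [e * d / c / 2], are multiplied by [c] in [P (U i - U j)] and
     by [1 / d] through the lower bound on [P]; this leaves [e]. *)
  have [|M hM] := exists_expr_le r01 (_ : 0 < e * d / c / 2).
    by rewrite !divr_gt0// mulr_gt0.
  exists M => i j Mi Mj x; rewrite -(ler_pM2l d0).
  apply: (le_trans (Pbelow _)).
  rewrite opAB -!(opM P) !PU !opE -scalerBr nrmZ (gtr0_norm c0).
  have -> : x - (N ^+ i) x - (x - (N ^+ j) x) = (N ^+ j) x - (N ^+ i) x.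
    by rewrite opprB addrC addrA subrK.
  have : nrm ((N ^+ j) x - (N ^+ i) x) <= (e * d / c / 2 + e * d / c / 2) * nrm x.
    rewrite mulrDl (le_trans (nrmD _ _))// nrmN lerD// (le_trans (nrmNX _ _))//.
      by rewrite ler_wpM2r ?nrm_ge0// hM.
    by rewrite ler_wpM2r ?nrm_ge0// hM.
  rewrite -splitr -(ler_pM2l c0) => /le_trans; apply.
  by rewrite le_eqVlt; apply/orP; left; apply/eqP; field; rewrite gt_eqF.
have PB : P * B = c%:C *: (1 : 'B(H)).
  apply: operator_eqP => x; apply/eqP; rewrite -subr_eq0; apply/eqP/nrm_eq0.
  apply/eqP; rewrite eq_le nrm_ge0 andbT.
  apply/ler_addgt0Pr => e e0; rewrite add0r.
  have n1 : 0 < nrm x + 1 by rewrite ltr_wpDl ?nrm_ge0.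
  have e1 : 0 < e / c / 2 / (nrm x + 1) by rewrite !divr_gt0.
  have [M1 hM1] := exists_expr_le r01 e1; have [M2 hM2] := hB _ e1.
  pose i := maxn M1 M2.
  have -> : (P * B) x - (c%:C *: (1 : 'B(H))) x =
            - P (U i x - B x) - c%:C *: (N ^+ i) x.
    rewrite opAB -(opM P (U i)) PU !opE scalerBr opprB; set u := P (B x).
    by rewrite -addrA; congr (_ + _); rewrite -opprD subrK.
  have hP := hk (U i x - B x).
  have h1 := hM1 i (leq_maxl _ _); have h2 := hM2 i (leq_maxr _ _) x.
  have h3 := nrmNX i x.
  apply: (le_trans (nrmD _ _)); rewrite !nrmN nrmZ (gtr0_norm c0).
  have kc : k <= c by rewrite lerDl ltW.
  have hP' : nrm (P (U i x - B x)) <= c * (e / c / 2 / (nrm x + 1) * nrm x).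
    rewrite (le_trans hP)// (le_trans (ler_wpM2l _ h2))// ler_wpM2r//.
    by rewrite mulr_ge0 ?nrm_ge0// ltW.
  have h3' : nrm ((N ^+ i) x) <= e / c / 2 / (nrm x + 1) * nrm x.
    by rewrite (le_trans h3)// ler_wpM2r ?nrm_ge0.
  apply: (le_trans (lerD hP' (ler_wpM2l (ltW c0) h3'))).
  rewrite -mulrDr -mulrDl -mulrDl -splitr.
  have -> : c * (e / c / (nrm x + 1) * nrm x) = e * (nrm x / (nrm x + 1)).
    by field; rewrite !gt_eqF.
  by rewrite ger_pMr// ler_pdivrMr// mul1r lerDl.
pose B' := (c^-1)%:C *: B.
have PB' : P * B' = 1.
  by rewrite opZAr PB scalerA -rmorphM /= mulVf ?gt_eqF// scale1r.
exists B'; split => //.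
(* The right inverse is also a left one: [P] sends [B' (P x) - x] to 0 and is bounded below. *)
apply: operator_eqP => x; apply/eqP; rewrite -subr_eq0; apply/eqP/nrm_eq0.
apply/eqP; rewrite eq_le nrm_ge0 andbT -(ler_pM2l d0) mulr0.
by rewrite (le_trans (Pbelow _))// opAB -!(opM P) mulrA PB' !opE subrr nrm0.
Qed.

(** For [l = a +i* b] with [b != 0], [T - l] is a commuting factor of [(T - a)^2 + b^2], which is
    coercive; for real [l] outside the interval, [T - l] or its opposite is coercive. *)
Lemma numrange_spectrum T (m M : R) : self_adjoint T ->
  (forall x, m * nrm x ^+ 2 <= ip (T x) x) ->
  (forall x, ip (T x) x <= M * nrm x ^+ 2) -> spectrum_in T `[m, M].
Proof.
move=> sT Tm TM [a b]; rewrite /spectrum /= => hspec.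
have {}hspec : ~ op_invertible (T - (a +i* b) *: (1 : 'B(H))) by [].
have [b0|b0] := eqVneq b 0; last first.
  case: hspec; pose S := T - a%:C *: (1 : 'B(H)); pose J : 'B(H) := (0 +i* b) *: (1 : 'B(H)).
  have sS : self_adjoint S by apply: saB => //; exact: sa_scalar.
  have -> : T - (a +i* b) *: (1 : 'B(H)) = S - J.
    rewrite /S /J -addrA -opprD -scalerDl; congr (_ - _ *: _).
    by apply/eqP; rewrite eq_complex /= addr0 add0r !eqxx.
  have SJ : S * J = J * S by rewrite /J opZAr opZAl mulr1 mul1r.
  apply: (@op_invertible_factor _ (S + J)).
    by apply: commrD; apply/commr_sym/commrB.
  have -> : (S - J) * (S + J) = S ^+ 2 + (b ^+ 2)%:C *: (1 : 'B(H)).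
    rewrite mulrBl (mulrDr S) (mulrDr J) SJ opprD addrA addrK; congr (_ + _).
    rewrite /J opZAl opZAr mulr1 scalerA -scaleNr; congr (_ *: _).
    by apply/eqP; rewrite eq_complex /= !mul0r !mulr0 addr0 sub0r opprK oppr0 expr2 !eqxx.
  apply: (@coercive_invertible _ (b ^+ 2)).
  - by apply: saD; [exact: saX | exact: sa_scalar].
  - by rewrite exprn_even_gt0.
  - move=> x; rewrite opD ipDl opZ op1 ipZl ipxx lerDr expr2 opM ip_sa//.
    by rewrite ipxx sqr_ge0.
exists a; last by rewrite b0.
rewrite b0 in hspec; rewrite /= in_itv /=; apply/andP; split; rewrite leNgt;
    apply/negP => ha; apply: hspec.
  apply: (@coercive_invertible _ (m - a)).
  - by apply: saB => //; exact: sa_scalar.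
  - by rewrite subr_gt0.
  - by move=> x; rewrite opB ipBl opZ op1 ipZl ipxx mulrBl lerB.
rewrite -opprB -scaleN1r; apply: op_invertibleZ; first by rewrite oppr_eq0 oner_eq0.
apply: (@coercive_invertible _ (a - M)).
- by apply: saB => //; exact: sa_scalar.
- by rewrite subr_gt0.
- by move=> x; rewrite opB ipBl opZ op1 ipZl ipxx mulrBl lerB.
Qed.

(** Since [x = B (T x)], [nrm (T x)] controls [nrm x], and by Cauchy-Schwarz the form of [T]
    controls [nrm (T x) ^+ 2]. The shifts by 1 keep the constant positive. *)
Lemma invertible_coercive T : self_adjoint T -> (forall x, 0 <= ip (T x) x) ->
  op_invertible T -> exists2 d : R, 0 < d & forall x, d * nrm x ^+ 2 <= ip (T x) x.
Proof.
move=> sT T0 [B [BT TB]].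
have [k k0 hk] := operator_bounded_nrm T; have [l l0 hl] := operator_bounded_nrm B.
have k1 : 0 < k + 1 by rewrite ltr_wpDl.
have l1 : 0 < l + 1 by rewrite ltr_wpDl.
exists (((l + 1) ^+ 2 * (k + 1))^-1) => [|x].
  by rewrite invr_gt0 mulr_gt0// exprn_gt0.
rewrite ler_pdivrMl; last by rewrite mulr_gt0// exprn_gt0.
have hx : nrm x <= (l + 1) * nrm (T x).
  have {1}-> : x = B (T x) by rewrite -opM BT.
  by rewrite (le_trans (hl _))// ler_wpM2r ?nrm_ge0// lerDl.
have hT : nrm (T x) ^+ 2 <= (k + 1) * ip (T x) x.
  apply: nrm_op_sqr_le => // z; apply: (le_trans (ip_cauchy_schwarz _ _)).
  rewrite expr2 mulrA ler_wpM2r ?nrm_ge0// (le_trans (hk _))//.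
  by rewrite ler_wpM2r ?nrm_ge0// lerDl.
rewrite -mulrA (le_trans _ (ler_wpM2l _ hT)) ?sqr_ge0// -exprMn.
by rewrite ler_pXn2r// ?nnegrE ?mulr_ge0 ?nrm_ge0// ltW.
Qed.

(** Take for [b] the supremum of the lower bounds of the form, finite thanks to the nonzero vector:
    were [T - b] invertible, it would be coercive and [b] could be increased. *)
Lemma numrange_bottom T : self_adjoint T -> (exists x : H, nrm x != 0) ->
  exists2 b : R, (forall x, b * nrm x ^+ 2 <= ip (T x) x) &
    ~ op_invertible (T - b%:C *: (1 : 'B(H))).
Proof.
move=> sT [x0 nx0]; have [k k0 hk] := operator_bounded_nrm T.
have n0 : 0 < nrm x0 ^+ 2 by rewrite exprn_gt0// lt_def nx0 nrm_ge0.
pose E : set R := [set b | forall x, b * nrm x ^+ 2 <= ip (T x) x].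
have E0 : E (- k).
  move=> x; rewrite mulNr lerNl -ipNl (le_trans (ip_cauchy_schwarz _ _))// nrmN.
  by rewrite expr2 mulrA ler_wpM2r ?nrm_ge0.
have Eub : ubound E (ip (T x0) x0 / nrm x0 ^+ 2).
  by move=> b Eb; rewrite ler_pdivlMr.
have Esup : has_sup E by split; [exists (- k) | exists (ip (T x0) x0 / nrm x0 ^+ 2)].
have ET x : sup E * nrm x ^+ 2 <= ip (T x) x.
  have [/nrm_eq0 ->|nz] := eqVneq (nrm x) 0.
    by rewrite nrm0 expr0n /= mulr0 ipC ip0l.
  have nx : 0 < nrm x ^+ 2 by rewrite exprn_gt0// lt_def nz nrm_ge0.
  rewrite -ler_pdivlMr//; apply: ge_sup; first by exists (- k).
  by move=> b Eb; rewrite ler_pdivlMr.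
exists (sup E) => // inv.
have [||d d0 hd] := invertible_coercive _ _ inv.
- by apply: saB => //; exact: sa_scalar.
- by move=> x; rewrite opB ipBl opZ op1 ipZl ipxx subr_ge0.
have : E (sup E + d).
  by move=> x; have := hd x; rewrite opB ipBl opZ op1 ipZl ipxx mulrDl; lra.
move=> /(sup_upper_bound Esup); lra.
Qed.

End Invertibility.

(** * Polynomials in an operator *)

Section PolynomialCalculus.
Variables (R : realType) (H : hilbertType R).
Implicit Types (A : 'B(H)) (p q : {poly R[i]}).

(** The complex counterpart of [poly_operator]: over [R[i]] every polynomial splits into linear
    factors. *)
Definition cpoly_operator (p : {poly R[i]}) A : 'B(H) := \sum_(k < size p) p`_k *: A ^+ k.

Lemma cpoly_operator_widen n p A : (size p <= n)%N ->
  cpoly_operator p A = \sum_(k < n) p`_k *: A ^+ k.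
Proof.
move=> pn; rewrite /cpoly_operator (big_ord_widen n (fun k => p`_k *: A ^+ k))// big_mkcond.
apply: eq_bigr => k _; case: ltnP => // pk.
by rewrite nth_default// scale0r.
Qed.

Lemma cpoly_operatorD p q A :
  cpoly_operator (p + q) A = cpoly_operator p A + cpoly_operator q A.
Proof.
pose n := maxn (size p) (size q).
rewrite !(@cpoly_operator_widen n) ?leq_maxl ?leq_maxr//; last exact: size_polyD.
by rewrite -big_split; apply: eq_bigr => k _; rewrite coefD scalerDl.
Qed.

Lemma cpoly_operatorZ c p A : cpoly_operator (c *: p) A = c *: cpoly_operator p A.
Proof.
rewrite !(@cpoly_operator_widen (size p)) ?size_scale_leq// scaler_sumr.
by apply: eq_bigr => k _; rewrite coefZ scalerA.
Qed.

Lemma cpoly_operatorC c A : cpoly_operator c%:P A = c *: (1 : 'B(H)).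
Proof.
by rewrite (@cpoly_operator_widen 1) ?size_polyC_leq1// big_ord1 coefC eqxx expr0.
Qed.

Lemma cpoly_operatorMX p A : cpoly_operator (p * 'X) A = cpoly_operator p A * A.
Proof.
have [->|p0] := eqVneq p 0; first by rewrite mul0r /cpoly_operator size_poly0 !big_ord0 mul0r.
rewrite /cpoly_operator size_mulX// big_ord_recl coefMX eqxx scale0r add0r mulr_suml.
by apply: eq_bigr => k _; rewrite coefMX /= opZAl -exprSr.
Qed.

Lemma cpoly_operatorM p q A :
  cpoly_operator (p * q) A = cpoly_operator p A * cpoly_operator q A.
Proof.
elim/poly_ind: q => [|q c IH].
  by rewrite mulr0 /cpoly_operator size_poly0 big_ord0 mulr0.
rewrite mulrDr mulrA !cpoly_operatorD !cpoly_operatorMX IH cpoly_operatorC.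
by rewrite mulrC mul_polyC cpoly_operatorZ mulrDr opZAr mulr1 mulrA.
Qed.

(** Splitting [p] makes [p(A)] a nonzero multiple of a product of factors [A - z], with [z] a root
    of [p]. *)
Lemma cpoly_operator_invertible p A : p != 0 ->
  (forall z, root p z -> op_invertible (A - z *: (1 : 'B(H)))) ->
  op_invertible (cpoly_operator p A).
Proof.
move=> p0 inv; have [r pE] := closed_field_poly_normal p.
rewrite pE cpoly_operatorZ; apply: op_invertibleZ; first by rewrite lead_coef_eq0.
have {}inv z : z \in r -> op_invertible (A - z *: (1 : 'B(H))).
  by move=> zr; apply: inv; rewrite pE rootZ ?lead_coef_eq0// root_prod_XsubC.
elim: r {pE} inv => [|z r IH] inv.
  by rewrite big_nil -polyC1 cpoly_operatorC scale1r; exists 1; rewrite mulr1.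
rewrite big_cons cpoly_operatorM; apply: op_invertibleM.
  rewrite -['X]mul1r cpoly_operatorD cpoly_operatorMX -polyC1 -polyCN.
  by rewrite !cpoly_operatorC scale1r mul1r scaleNr; apply: inv; rewrite mem_head.
by apply: IH => w wr; apply: inv; rewrite inE wr orbT.
Qed.

Lemma poly_operatorE (p : {poly R}) A :
  poly_operator p A = cpoly_operator (map_poly (real_complex R) p) A.
Proof.
rewrite /poly_operator /cpoly_operator size_map_poly.
by apply: eq_bigr => k _; rewrite coef_map.
Qed.

Lemma poly_operatorD (p q : {poly R}) A :
  poly_operator (p + q) A = poly_operator p A + poly_operator q A.
Proof. by rewrite !poly_operatorE rmorphD cpoly_operatorD. Qed.

Lemma poly_operatorM (p q : {poly R}) A :
  poly_operator (p * q) A = poly_operator p A * poly_operator q A.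
Proof. by rewrite !poly_operatorE rmorphM cpoly_operatorM. Qed.

Lemma poly_operatorC (c : R) A : poly_operator c%:P A = c%:C *: (1 : 'B(H)).
Proof. by rewrite poly_operatorE map_polyC cpoly_operatorC. Qed.

Lemma poly_operatorZ (c : R) (p : {poly R}) A :
  poly_operator (c *: p) A = c%:C *: poly_operator p A.
Proof. by rewrite -mul_polyC poly_operatorM poly_operatorC opZAl mul1r. Qed.

Lemma poly_operatorN (p : {poly R}) A : poly_operator (- p) A = - poly_operator p A.
Proof. by rewrite -scaleN1r poly_operatorZ rmorphN rmorph1 scaleN1r. Qed.

Lemma poly_operatorB (p q : {poly R}) A :
  poly_operator (p - q) A = poly_operator p A - poly_operator q A.
Proof. by rewrite poly_operatorD poly_operatorN. Qed.

Lemma poly_operatorX A : poly_operator 'X A = A.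
Proof.
rewrite poly_operatorE map_polyX -['X]mul1r cpoly_operatorMX -polyC1.
by rewrite cpoly_operatorC scale1r mul1r.
Qed.

Lemma sa_poly_operator (p : {poly R}) A : self_adjoint A -> self_adjoint (poly_operator p A).
Proof. by move=> sA; apply: sa_sum => k _; apply/saZ/saX. Qed.

End PolynomialCalculus.

(** * Positivity on the spectrum and the continuous functional calculus *)

Section SpectralPositivity.
Variables (R : realType) (H : hilbertType R) (A : 'B(H)) (m M : R).
Hypotheses (sA : self_adjoint A) (specA : spectrum_in A `[m, M]).
Implicit Types (p q : {poly R}) (f : R -> R) (B : 'B(H)).

Let real_spectrum_of z : ~ op_invertible (A - z *: (1 : 'B(H))) ->
  exists2 t, real_spectrum A t & z = t%:C.
Proof.
move=> ninv; have Az : spectrum A z by [].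
by have [t _ tz] := specA Az; exists t; rewrite // /real_spectrum /= tz.
Qed.

Lemma real_spectrum_itv t : real_spectrum A t -> m <= t <= M.
Proof. by move=> /specA[s]; rewrite /= in_itv /= => smM [<-]. Qed.

(* Spectral mapping: the bottom b of the numerical range of q(A) lies in its
   spectrum, so some complex root z of q - b lies in the spectrum of A; z is
   then real and b = q(z). *)
Lemma poly_operator_ge0 q : (forall t, real_spectrum A t -> 0 <= q.[t]) ->
  operator_ge0 (poly_operator q A).
Proof.
move=> q0; have sq := sa_poly_operator q sA.
apply: ip_op_ge0 => // x.
have [/nrm_eq0 ->|nx] := eqVneq (nrm x) 0; first by rewrite ipC ip0l.
have [b bq ninv] := numrange_bottom sq (ex_intro _ x nx).
have [b0|b0] := leP 0 b; first by apply: le_trans (bq x); rewrite mulr_ge0// sqr_ge0.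
exfalso.
(* A constant [q] has no factorization to use; instead, [H] being nonzero, [A] has a spectral point
   [t], where [q.[t] = b < 0]. *)
have [qb|qb] := eqVneq (q - b%:P) 0.
  have [c _ ninvc] := numrange_bottom sA (ex_intro _ x nx).
  have [t At _] := real_spectrum_of ninvc.
  have := q0 t At; move/eqP: qb; rewrite subr_eq0 => /eqP ->.
  by rewrite hornerC leNgt b0.
apply: ninv; rewrite -(poly_operatorC b A) -poly_operatorB poly_operatorE.
apply: cpoly_operator_invertible => [|z rz]; first by rewrite map_poly_eq0.
apply: contrapT => /real_spectrum_of[t At zt].
move: rz; rewrite zt fmorph_root /root hornerD hornerN hornerC subr_eq0 => /eqP qt.
by have := q0 t At; rewrite qt leNgt b0.
Qed.

(** Positivity is applied to [e ^+ 2 - q * q], whose form at [x] compares the squares of the two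
    sides. *)
Lemma nrm_poly_operator_le q (e : R) x : 0 <= e ->
  (forall t, real_spectrum A t -> `|q.[t]| <= e) ->
  nrm (poly_operator q A x) <= e * nrm x.
Proof.
move=> e0 qe.
have /op_ge0_ip : operator_ge0 (poly_operator ((e ^+ 2)%:P - q * q) A).
  apply: poly_operator_ge0 => t At; rewrite hornerD hornerN hornerC hornerM -expr2.
  by rewrite subr_ge0 -real_normK ?num_real// ler_pXn2r ?nnegrE// qe.
move=> /(_ x); rewrite poly_operatorB poly_operatorM poly_operatorC !opE ipBl ipZl.
rewrite (ip_sa _ _ (sa_poly_operator q sA)) !ipxx -exprMn subr_ge0.
by rewrite ler_pXn2r// nnegrE ?mulr_ge0 ?nrm_ge0.
Qed.

(** By the norm bound above, uniform convergence on [[m, M]] makes the operators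
    [poly_operator (p k) A] a Cauchy sequence. Its limit satisfies [is_cfc], so [cfc] does not take
    its default value. *)
Lemma cfc_is_cfc f (p : nat -> {poly R}) :
  (forall e : R, 0 < e -> exists N, forall k, (N <= k)%N ->
     forall t, m <= t <= M -> `|(p k).[t] - f t| <= e) ->
  is_cfc f A (cfc f A).
Proof.
move=> pf; apply: xgetPex.
have [e e0|B hB] := @operator_cauchy_cvg _ _ (fun k => poly_operator (p k) A).
  have [|N hN] := pf (e / 2); first by rewrite divr_gt0.
  exists N => k l Nk Nl x; rewrite -opB -poly_operatorB.
  apply: nrm_poly_operator_le => [|t /real_spectrum_itv tmM]; first exact: ltW.
  rewrite hornerD hornerN [e]splitr.
  have -> : (p k).[t] - (p l).[t] = ((p k).[t] - f t) - ((p l).[t] - f t) by ring.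
  by rewrite (le_trans (ler_normB _ _))// lerD// hN.
exists B, p; split => // e e0; have [N hN] := pf e e0.
by exists N => // k /= Nk t /real_spectrum_itv; exact: hN.
Qed.

Lemma is_cfcN f B : is_cfc f A B -> is_cfc (fun t => - f t) A (- B).
Proof.
move=> [p [pf /operator_cvgP pB]]; exists (fun k => - p k); split.
  move=> e /pf[N _ hN]; exists N => // k Nk t At.
  by rewrite hornerN -opprD normrN; exact: hN.
apply/operator_cvgP => e /pB[N hN]; exists N => k Nk x.
by rewrite poly_operatorN !opN -opprD nrmN; exact: hN.
Qed.

Lemma is_cfc_ip f B (e : R) : is_cfc f A B -> 0 < e ->
  exists p, (forall t, real_spectrum A t -> `|p.[t] - f t| <= e) /\
    forall x y, `|ip (poly_operator p A x - B x) y| <= e * nrm x * nrm y.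
Proof.
move=> [p [pf /operator_cvgP pB]] e0.
have [N1 _ hN1] := pf e e0; have [N2 hN2] := pB e e0.
exists (p (maxn N1 N2)); split; first by apply: hN1; exact: leq_maxl.
have bound x y : ip (poly_operator (p (maxn N1 N2)) A x - B x) y <= e * nrm x * nrm y.
  apply: (le_trans (ip_cauchy_schwarz _ _)); rewrite ler_wpM2r ?nrm_ge0//.
  by apply: hN2; exact: leq_maxr.
move=> x y; rewrite ler_norml bound andbT lerNl -ipNr -(nrmN y).
exact: bound.
Qed.

Lemma sa_is_cfc f B : is_cfc f A B -> self_adjoint B.
Proof.
move=> fB; apply: ip_symmetric_sa => x y.
apply/eqP; rewrite -subr_eq0 -normr_eq0 eq_le normr_ge0 andbT.
apply/ler_addgt0Pr => e e0; rewrite add0r.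
(* Two errors [e / c * nrm x * nrm y] add up to [e * ((c - 1) / c)], at most [e]; the summand 1
   keeps [c] positive. *)
pose c := 2 * (nrm x * nrm y) + 1.
have c0 : 0 < c by rewrite ltr_wpDl// mulr_ge0// mulr_ge0// nrm_ge0.
have [|p [_ hp]] := is_cfc_ip (e := e / c) fB; first by rewrite divr_gt0.
have := hp x y; have := hp y x; rewrite !ipBl (ipC (poly_operator p A y)).
rewrite -(ip_sa x y (sa_poly_operator p sA)) (ipC (B y)).
set a := ip _ y; set b := ip _ y; set d := ip x _ => h1 h2.
have -> : b - d = (a - d) - (a - b) by ring.
rewrite (le_trans (ler_normB _ _))// (le_trans (lerD h1 h2))//.
have -> : e / c * nrm y * nrm x + e / c * nrm x * nrm y = e * ((c - 1) / c).
  by rewrite /c; field; rewrite gt_eqF.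
by rewrite ger_pMr// ler_pdivrMr// mul1r gerBl.
Qed.

(** If [p] is within [e / c] of [f] on the spectrum, [q + e / c - p] is nonnegative there.
    Positivity gives the claim up to two errors, the shift and the distance from [p(A)] to [B], and
    [e] is arbitrary. *)
Lemma is_cfc_le f B q : is_cfc f A B ->
  (forall t, real_spectrum A t -> f t <= q.[t]) ->
  operator_le B (poly_operator q A).
Proof.
move=> fB fq; apply: ip_op_ge0.
  by apply: saB; [exact: sa_poly_operator | exact: sa_is_cfc fB].
move=> x; rewrite -oppr_le0; apply/ler_addgt0Pr => e e0; rewrite add0r.
pose c := 2 * nrm x ^+ 2 + 1.
have c0 : 0 < c by rewrite ltr_wpDl// mulr_ge0// sqr_ge0.
have ec0 : 0 < e / c by rewrite divr_gt0.
have [p [pf hp]] := is_cfc_ip fB ec0.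
have /op_ge0_ip : operator_ge0 (poly_operator (q + (e / c)%:P - p) A).
  apply: poly_operator_ge0 => t At; rewrite !hornerE.
  by have := fq t At; have := pf t At; rewrite ler_norml; lra.
move=> /(_ x); rewrite poly_operatorB poly_operatorD poly_operatorC !opE.
have := hp x x; rewrite !(ipBl, ipDl, ipZl) ipxx ler_norml -mulrA -expr2.
have : e / c * nrm x ^+ 2 * 2 <= e.
  have -> : e / c * nrm x ^+ 2 * 2 = e * ((c - 1) / c).
    by rewrite /c; field; rewrite gt_eqF.
  by rewrite ger_pMr// ler_pdivrMr// mul1r gerBl.
set v := e / c * _; lra.
Qed.

Lemma is_cfc_ge f B q : is_cfc f A B ->
  (forall t, real_spectrum A t -> q.[t] <= f t) ->
  operator_le (poly_operator q A) B.
Proof.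
move=> /is_cfcN fB qf; rewrite /operator_le -[B]opprK addrC -poly_operatorN.
by apply: is_cfc_le fB _ => t At; rewrite hornerN lerN2 qf.
Qed.

End SpectralPositivity.

(** * Derivatives relative to a set *)

Section RealDerivatives.
Variables (R : realType) (D : set R).
Implicit Types (f g : R -> R) (x y e : R).

(** The difference quotient is multiplied out, so that [y = x] is no exception. *)
Definition derivative_at_on f x l := forall e, 0 < e -> exists2 d, 0 < d &
  forall y, D y -> `|y - x| < d -> `|f y - f x - l * (y - x)| <= e * `|y - x|.

Lemma has_derivative_on_at f f' x : has_derivative_on D f f' -> D x ->
  derivative_at_on f x (f' x).
Proof.
move=> hf Dx e e0.
have : \forall y \near within D x^', `|f' x - (f y - f x) / (y - x)| <= e.
  by have /cvgrPdist_le := hf x Dx; apply.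
rewrite near_withinE near_withinE => /nbhs_ballP[d /= d0 hd]; exists d => // y Dy yd.
have [->|yx] := eqVneq y x; first by rewrite !subrr mulr0 subrr normr0 mulr0.
have := hd y; rewrite /ball /= distrC => /(_ yd yx Dy) h.
have yx0 : y - x != 0 by rewrite subr_eq0.
have -> : f y - f x - f' x * (y - x) = - (f' x - (f y - f x) / (y - x)) * (y - x).
  by rewrite opprB mulrBl divfK.
by rewrite normrM normrN ler_wpM2r.
Qed.

Lemma derivative_at_on_quadratic f x l (a b c : R) : derivative_at_on f x l ->
  derivative_at_on (fun t => f t - (a * t ^+ 2 + b * t + c)) x (l - (2 * a * x + b)).
Proof.
move=> hf e e0; have e2 : 0 < e / 2 by rewrite divr_gt0.
(* Up to sign, the quadratic adds exactly [a * (y - x) ^+ 2] to the remainder; [d'] keeps it within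
   half of the allowed error. *)
have [d d0 hd] := hf _ e2; pose d' := e / 2 / (`|a| + 1).
have a1 : 0 < `|a| + 1 by rewrite ltr_wpDl.
exists (Num.min d d') => [|y Dy]; first by rewrite lt_min d0 divr_gt0.
rewrite lt_min => /andP[yd yd'].
have -> : f y - (a * y ^+ 2 + b * y + c) - (f x - (a * x ^+ 2 + b * x + c)) -
  (l - (2 * a * x + b)) * (y - x) = f y - f x - l * (y - x) - a * (y - x) * (y - x).
  by ring.
rewrite (le_trans (ler_normB _ _))// [e]splitr mulrDl lerD ?hd// normrM ler_wpM2r//.
rewrite normrM; move: yd'; rewrite /d' ltr_pdivlMr// => /ltW; apply: le_trans.
by rewrite mulrC ler_wpM2l// lerDl.
Qed.

Lemma derivative_at_onN f x l : derivative_at_on f x l ->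
  derivative_at_on (fun t => - f t) x (- l).
Proof.
move=> hf e /hf[d d0 hd]; exists d => // y Dy yd.
by rewrite mulNr -!opprD normrN; exact: hd.
Qed.

Lemma derivative_at_on_continuous f x l : derivative_at_on f x l -> D x ->
  f @ within D (nbhs x) --> f x.
Proof.
move=> hf Dx; apply/cvgrPdist_le => e e0.
have [d d0 hd] := hf 1 ltr01; pose k := `|l| + 1.
have k0 : 0 < k by rewrite ltr_wpDl.
rewrite near_withinE; apply/nbhs_ballP; exists (Num.min d (e / k)).
  by rewrite /= lt_min d0 divr_gt0.
move=> y; rewrite /ball /= distrC lt_min => /andP[yd ye] Dy; rewrite distrC.
have -> : f y - f x = (f y - f x - l * (y - x)) + l * (y - x) by ring.
rewrite (le_trans (ler_normD _ _))// normrM.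
move: ye; rewrite ltr_pdivlMr// => /ltW; apply: le_trans.
by have := hd y Dy yd; rewrite /k; lra.
Qed.

End RealDerivatives.

(** * Mean values, interpolating quadratics and a Taylor estimate *)

Section RealAnalysis.
Variables (R : realType) (m M : R).
Implicit Types (f g : R -> R) (x y e : R).

Local Notation derivative_on f f' :=
  (forall x, m <= x <= M -> derivative_at_on `[m, M] f x (f' x)).

(** Inside [(a, b)] the relative derivative is two-sided, and it also gives continuity on [[a, b]],
    so the classical mean value theorem applies. *)
Lemma mean_value_on f f' a b : derivative_on f f' -> m <= a -> a < b -> b <= M ->
  exists2 c, a < c < b & f b - f a = f' c * (b - a).
Proof.
move=> hf ma ab bM.
have inm x : a <= x <= b -> m <= x <= M.
  by move=> /andP[ax xb]; rewrite (le_trans ma ax) (le_trans xb bM).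
have [||c] := @MVT R f f' a b ab; last by rewrite in_itv /=; exists c.
  move=> x; rewrite in_itv /= => /andP[ax xb].
  have xmM : m <= x <= M by apply: inm; rewrite !ltW.
  suff cv : (fun h => h^-1 *: (f (h *: 1 + x) - f x)) @ (0 : R)^' --> f' x.
    apply: DeriveDef; first by apply/cvg_ex; exists (f' x).
    exact: cvg_lim cv.
  apply/cvgrPdist_le => e e0; have [d d0 hd] := hf x xmM e e0.
  rewrite near_withinE; apply/nbhs_ballP.
  exists (Num.min d (Num.min (x - a) (b - x))).
    by rewrite /= !lt_min d0 !subr_gt0 ax xb.
  move=> h; rewrite /ball /= sub0r normrN !lt_min => /andP[hd' /andP[h1 h2]] h0.
  have h3 := ler_norm h; have h4 := ler_norm (- h); rewrite normrN in h4.
  have Dh : `[m, M]%classic (h *: 1 + x).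
    by rewrite /= in_itv /=; apply: inm; rewrite /GRing.scale /= mulr1; lra.
  have := hd _ Dh; rewrite addrK /GRing.scale /= mulr1 => /(_ hd') hh.
  have -> : f' x - h^-1 * (f (h + x) - f x) = - h^-1 * (f (h + x) - f x - f' x * h).
    by field.
  rewrite normrM normrN normfV mulrC ler_pdivrMr// normr_gt0//.
apply/subspace_continuousP => x; rewrite /= in_itv /= => xab.
apply: (@derivative_at_on_continuous _ _ _ _ (f' x)) => [e e0|]; last by rewrite /= in_itv.
have [d d0 hd] := hf x (inm _ xab) e e0; exists d => // y.
by rewrite /= in_itv /= => yab; apply: hd; rewrite /= in_itv /= inm.
Qed.

(** Were [f] positive at [x], [f'] would be positive somewhere before [x] and negative somewhere
    after it, against [0 <= f'']. *)
Lemma convex_le0 f f' f'' : derivative_on f f' -> derivative_on f' f'' ->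
  (forall x, m <= x <= M -> 0 <= f'' x) -> f m = 0 -> f M = 0 ->
  forall x, m <= x <= M -> f x <= 0.
Proof.
move=> hf hf' f''0 fm fM x /andP[mx xM]; rewrite leNgt; apply/negP => fx.
have {mx}mx : m < x by rewrite lt_neqAle mx andbT; apply: contraTneq fx => <-; rewrite fm ltxx.
have {xM}xM : x < M by rewrite lt_neqAle xM andbT; apply: contraTneq fx => ->; rewrite fM ltxx.
have [c1 /andP[mc1 c1x] e1] := mean_value_on hf (lexx m) mx (ltW xM).
have [c2 /andP[xc2 c2M] e2] := mean_value_on hf (ltW mx) xM (lexx M).
have [c3 /andP[c13 c32] e3] := mean_value_on hf' (ltW mc1) (lt_trans c1x xc2) (ltW c2M).
have p1 : 0 < f' c1.
  by rewrite -(@pmulr_lgt0 _ (x - m)) ?subr_gt0// -e1 fm subr0.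
have p2 : f' c2 < 0.
  by rewrite -(@pmulr_llt0 _ (M - x)) ?subr_gt0// -e2 fM sub0r oppr_lt0.
have p3 : 0 <= f' c2 - f' c1.
  rewrite e3 mulr_ge0//; last by rewrite subr_ge0 ltW// (lt_trans c1x).
  by apply: f''0; rewrite (le_trans (ltW mc1) (ltW c13)) (le_trans (ltW c32) (ltW c2M)).
lra.
Qed.

Definition quadratic (a b c : R) : {poly R} := a *: 'X^2 + b *: 'X + c%:P.

Lemma horner_quadratic a b c x : (quadratic a b c).[x] = a * x ^+ 2 + b * x + c.
Proof. by rewrite /quadratic !hornerE. Qed.

Lemma convex_chord_le f f' f'' (gamma : R) : m < M ->
  derivative_on f f' -> derivative_on f' f'' ->
  (forall x, m <= x <= M -> gamma <= f'' x) ->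
  exists b c, [/\ (quadratic (gamma / 2) b c).[m] = f m,
    (quadratic (gamma / 2) b c).[M] = f M &
    forall x, m <= x <= M -> f x <= (quadratic (gamma / 2) b c).[x]].
Proof.
move=> mM hf hf' f''g; have mM0 : M - m != 0 by rewrite subr_eq0 gt_eqF.
(* The interpolant is the chord of [f] plus [a * (t - m) * (t - M)]; [b] and [c] are its expanded
   coefficients. *)
pose a := gamma / 2; pose s := (f M - f m) / (M - m).
pose b := s - a * (M + m); pose c := f m - s * m + a * M * m.
have qm : (quadratic a b c).[m] = f m by rewrite horner_quadratic /b /c; ring.
have qM : (quadratic a b c).[M] = f M.
  have -> : f M = f m + s * (M - m) by rewrite divfK// addrC subrK.
  by rewrite horner_quadratic /b /c; ring.
exists b, c; split => // x xmM; rewrite -/a horner_quadratic -subr_le0.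
apply: (@convex_le0 (fun t => f t - (a * t ^+ 2 + b * t + c))
          (fun t => f' t - (2 * a * t + b)) (fun t => f'' t - gamma)) => //.
- by move=> t tmM; apply: derivative_at_on_quadratic; exact: hf.
- move=> t tmM; have := derivative_at_on_quadratic 0 (2 * a) b (hf' t tmM).
  rewrite (_ : 2 * 0 * t + 2 * a = gamma); last by rewrite /a; field.
  by congr derivative_at_on; apply/funext => ?; rewrite mul0r add0r.
- by move=> t tmM; rewrite subr_ge0 f''g.
- by rewrite -horner_quadratic qm subrr.
- by rewrite -horner_quadratic qM subrr.
Qed.

Lemma concave_chord_ge f f' f'' (gamma : R) : m < M ->
  derivative_on f f' -> derivative_on f' f'' ->
  (forall x, m <= x <= M -> f'' x <= gamma) ->
  exists b c, [/\ (quadratic (gamma / 2) b c).[m] = f m,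
    (quadratic (gamma / 2) b c).[M] = f M &
    forall x, m <= x <= M -> (quadratic (gamma / 2) b c).[x] <= f x].
Proof.
move=> mM hf hf' f''g.
have [|||b [c [qm qM fq]]] := @convex_chord_le (fun t => - f t) (fun t => - f' t)
    (fun t => - f'' t) (- gamma) mM.
- by move=> x xmM; apply: derivative_at_onN; exact: hf.
- by move=> x xmM; apply: derivative_at_onN; exact: hf'.
- by move=> x xmM; rewrite lerN2 f''g.
have qN x : (quadratic (gamma / 2) (- b) (- c)).[x] = - (quadratic (- gamma / 2) b c).[x].
  by rewrite !horner_quadratic; ring.
exists (- b), (- c); split => [||x xmM]; rewrite qN ?qm ?qM ?opprK//.
by rewrite lerNl fq.
Qed.

(** Two mean values, for [f] and then for [f'], give the remainder without the factor 1/2, which is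
    enough for the Bernstein estimate. *)
Lemma taylor_le f f' f'' (C : R) : derivative_on f f' -> derivative_on f' f'' ->
  (forall x, m <= x <= M -> `|f'' x| <= C) ->
  forall x y, m <= x <= M -> m <= y <= M ->
  `|f y - f x - f' x * (y - x)| <= C * (y - x) ^+ 2.
Proof.
move=> hf hf' hC x y /andP[mx xM] /andP[my yM].
have C0 : 0 <= C by apply: le_trans (hC x _); rewrite ?normr_ge0// mx xM.
have [xy|yx|->] := ltgtP x y; last by rewrite !subrr mulr0 subrr normr0 expr0n /= mulr0.
  have [c /andP[xc cy] e1] := mean_value_on hf mx xy yM.
  have [d /andP[xd dc] e2] := mean_value_on hf' mx xc (le_trans (ltW cy) yM).
  have -> : f y - f x - f' x * (y - x) = f'' d * (c - x) * (y - x).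
    by rewrite -e2 e1; ring.
  have dC : `|f'' d| <= C by apply: hC; lra.
  rewrite !normrM expr2 mulrA ler_pM// ?mulr_ge0//; last by rewrite ger0_norm; lra.
  by rewrite ler_pM// ger0_norm; lra.
have [c /andP[yc cx] e1] := mean_value_on hf my yx xM.
have [d /andP[cd dx] e2] := mean_value_on hf' (le_trans my (ltW yc)) cx xM.
have -> : f y - f x - f' x * (y - x) = f'' d * (x - c) * (x - y).
  by rewrite -e2 -[f y - f x]opprB e1; ring.
have dC : `|f'' d| <= C by apply: hC; lra.
have -> : (y - x) ^+ 2 = (x - y) ^+ 2 by ring.
rewrite !normrM expr2 mulrA ler_pM// ?mulr_ge0//; last by rewrite ger0_norm; lra.
by rewrite ler_pM// ger0_norm; lra.
Qed.

End RealAnalysis.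

(** * Uniform approximation by Bernstein polynomials *)

Section Bernstein.
Variable R : realFieldType.
Implicit Types (g : nat -> R) (u : R).

(* The Bernstein polynomial, in u, of the expected value of [g S_n] for S_n a
   binomial variable with parameters n and u, by conditioning on one trial. *)
Fixpoint bernstein n g : {poly R} :=
  if n is n'.+1 then 'X * bernstein n' (g \o S) + (1 - 'X) * bernstein n' g
  else (g 0%N)%:P.

Lemma bernstein_le n g g' u : 0 <= u <= 1 -> (forall k, (k <= n)%N -> g k <= g' k) ->
  (bernstein n g).[u] <= (bernstein n g').[u].
Proof.
move=> /andP[u0 u1]; elim: n g g' => [|n IH] g g' gg' /=; first by rewrite !hornerE gg'.
rewrite !hornerE lerD// ler_wpM2l ?subr_ge0// IH// => k kn; apply: gg' => //.
exact: leqW.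
Qed.

(** The first two moments of the binomial law, by induction: shifting the argument by one keeps the
    function quadratic. *)
Lemma bernstein_quadratic n (a b c : R) u :
  (bernstein n (fun k => a + b * k%:R + c * k%:R ^+ 2)).[u] =
  a + b * (n%:R * u) + c * (n%:R * u * (1 - u) + (n%:R * u) ^+ 2).
Proof.
elim: n a b c => [|n IH] a b c; first by rewrite /= hornerC; ring.
rewrite [bernstein _ _]/=; set g1 := _ \o S.
have -> : g1 = (fun k => (a + b + c) + (b + 2 * c) * k%:R + c * k%:R ^+ 2).
  by apply/funext => k; rewrite /g1 /= -natr1; ring.
rewrite -polyC1 hornerD !hornerM hornerD hornerN hornerX hornerC !IH -natr1; ring.
Qed.

End Bernstein.

(** Around each [t], the hypothesis squeezes [f] between two parabolas [q (- C)] and [q C] that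
    touch it at [t]. Bernstein polynomials are monotone in the function and explicit on quadratics,
    so the error at [t] is at most [C] times a variance of order [1 / n]. *)
Lemma bernstein_approx (R : realType) (m M C : R) (f f' : R -> R) : m < M ->
  (forall x y, m <= x <= M -> m <= y <= M ->
     `|f y - f x - f' x * (y - x)| <= C * (y - x) ^+ 2) ->
  exists p : nat -> {poly R}, forall e : R, 0 < e ->
    exists N, forall k, (N <= k)%N ->
      forall t, m <= t <= M -> `|(p k).[t] - f t| <= e.
Proof.
move=> mM hC; pose w := M - m; have w0 : 0 < w by rewrite subr_gt0.
have C0 : 0 <= C.
  have := hC m M; rewrite !lexx ltW// => /(_ isT isT) h.
  by rewrite -(pmulr_lge0 _ (_ : 0 < (M - m) ^+ 2)) ?exprn_gt0// (le_trans _ h).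
pose pt n k : R := m + w * (k%:R / n.+1%:R).
exists (fun n => bernstein n.+1 (fun k => f (pt n k)) \Po (w^-1 *: ('X - m%:P))) => e e0.
have D0 : 0 < C * w ^+ 2 + 1 by rewrite ltr_wpDl// mulr_ge0// sqr_ge0.
have [N _ hN] := near_infty_natSinv_lt (PosNum (divr_gt0 e0 D0)).
exists N => n Nn t tmM; have /andP[mt tM] := tmM.
pose u := (t - m) / w; rewrite horner_comp.
have -> : (w^-1 *: ('X - m%:P)).[t] = u by rewrite !hornerE mulrC.
have u01 : 0 <= u <= 1.
  by rewrite divr_ge0 ?(ltW w0)//= ?ler_pdivrMr// ?mul1r; rewrite /w; lra.
have n0 : n.+1%:R != 0 :> R by rewrite pnatr_eq0.
have ptE k : pt n k - t = w * (k%:R / n.+1%:R - u).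
  have wu : w * u = t - m by rewrite /u mulrC divfK ?gt_eqF.
  by rewrite /pt mulrBr wu; ring.
have bound k : (k <= n.+1)%N ->
    `|f (pt n k) - f t - f' t * (pt n k - t)| <= C * (pt n k - t) ^+ 2.
  move=> kn; apply: hC => //.
  have k1 : 0 <= (k%:R / n.+1%:R : R) <= 1.
    by rewrite divr_ge0//= ler_pdivrMr ?ltr0n// mul1r ler_nat.
  have /andP[k1a k1b] := k1.
  have := ler_wpM2l (ltW w0) k1b; have := mulr_ge0 (ltW w0) k1a.
  by rewrite /pt mulr1; move: (w * (_ / _)) => z; rewrite /w; lra.
pose q (s : R) k := f t + f' t * (pt n k - t) + s * (pt n k - t) ^+ 2.
have [K quad err] : exists2 K, forall s : R, (bernstein n.+1 (q s)).[u] = f t + s * K &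
    C * K <= e.
  (* The variance of the random node [pt n k], whose mean is [t]. *)
  exists (w ^+ 2 * (u * (1 - u)) / n.+1%:R) => [s|].
    rewrite (_ : q s = fun k => (f t - f' t * w * u + s * w ^+ 2 * u ^+ 2) +
       (f' t * w / n.+1%:R - s * w ^+ 2 * 2 * u / n.+1%:R) * k%:R +
       (s * w ^+ 2 / n.+1%:R ^+ 2) * k%:R ^+ 2); last first.
      by apply/funext => k; rewrite /q ptE; field.
    by rewrite bernstein_quadratic; field.
  have := hN n Nn; rewrite /= ltr_pdivlMr// mulrC => /ltW; apply: le_trans.
  rewrite 2!mulrA ler_wpM2r ?invr_ge0 ?ler0n//.
  have cw : 0 <= C * w ^+ 2 by rewrite mulr_ge0// sqr_ge0.
  have uu : u * (1 - u) <= 1 by move: u01; nra.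
  by rewrite (le_trans (ler_wpM2l cw uu))// mulr1 lerDl.
have lower k : (k <= n.+1)%N -> q (- C) k <= f (pt n k).
  by move=> /bound; rewrite ler_norml /q; lra.
have upper k : (k <= n.+1)%N -> f (pt n k) <= q C k.
  by move=> /bound; rewrite ler_norml /q; lra.
rewrite ler_norml; apply/andP; split.
  by have := bernstein_le u01 lower; rewrite quad; lra.
by have := bernstein_le u01 upper; rewrite quad; lra.
Qed.

(** * Positive maps and the Jensen-Mercer comparison *)

Lemma positive_map_sa (R : realType) (H K : hilbertType R)
    (Phi : {linear 'B(H) -> 'B(K)}) (A : 'B(H)) :
  positive_map Phi -> self_adjoint A -> self_adjoint (Phi A).
Proof.
move=> Phi_pos sA; have [k k0 hk] := operator_bounded_nrm A.
(* [A] is the difference of the positive operators [A + k] and [k], and positive operators are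
   self-adjoint. *)
have Ak : operator_ge0 (A + k%:C *: (1 : 'B(H))).
  apply: ip_op_ge0 => [|x]; first by apply: saD => //; exact: sa_scalar.
  rewrite opD ipDl opZ op1 ipZl ipxx -lerBlDr sub0r lerNl -ipNl.
  rewrite (le_trans (ip_cauchy_schwarz _ _))// nrmN expr2 mulrA.
  by rewrite ler_wpM2r ?nrm_ge0.
have Phi1 : operator_ge0 (Phi 1).
  by apply: Phi_pos => x; rewrite op1 innerxx lecR sqr_ge0.
rewrite -[A](addrK (k%:C *: (1 : 'B(H)))) linearB linearZ /=.
by apply: saB; [exact/op_ge0_sa/Phi_pos | exact/saZ/op_ge0_sa].
Qed.

Section JensenMercer.
Variables (R : realType) (H K : hilbertType R) (m M : R) (n : nat).
Variables (A : 'I_n -> 'B(H)) (Phi : 'I_n -> {linear 'B(H) -> 'B(K)}).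
Hypotheses (A_sa : forall i, self_adjoint (A i))
  (A_spec : forall i, spectrum_in (A i) `[m, M])
  (Phi_pos : forall i, positive_map (Phi i))
  (Phi_one : \sum_(i < n) Phi i 1 = 1).

Let S : 'B(K) := \sum_(i < n) Phi i (A i).
Let V : 'B(K) := \sum_(i < n) Phi i (A i ^+ 2).
Let J : 'B(K) := (M + m)%:C *: S - (M * m)%:C *: (1 : 'B(K))
  - (2^-1)%:C *: (S ^+ 2 + V).
Let T : 'B(K) := (M + m)%:C *: (1 : 'B(K)) - S.

Let sS : self_adjoint S.
Proof. by apply: sa_sum => i _; exact: positive_map_sa. Qed.

Let sJ : self_adjoint J.
Proof.
have sV : self_adjoint V by apply: sa_sum => i _; apply: positive_map_sa => //; exact: saX.
apply: saB; last by apply: saZ; apply: saD => //; exact: saX.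
by apply: saB; [exact: saZ | exact: sa_scalar].
Qed.

Let sT : self_adjoint T.
Proof. by apply: saB => //; exact: sa_scalar. Qed.

Lemma poly_operator_quadratic (L : hilbertType R) (B : 'B(L)) (a b c : R) :
  poly_operator (quadratic a b c) B = a%:C *: B ^+ 2 + b%:C *: B + c%:C *: (1 : 'B(L)).
Proof.
rewrite /quadratic !poly_operatorD !poly_operatorZ poly_operatorC poly_operatorX.
by rewrite ['X^2]expr2 poly_operatorM poly_operatorX expr2.
Qed.

Let sum_Phi_le (B C : 'I_n -> 'B(H)) : (forall i, operator_le (B i) (C i)) ->
  operator_le (\sum_(i < n) Phi i (B i)) (\sum_(i < n) Phi i (C i)).
Proof.
move=> BC; rewrite /operator_le -sumrB; apply: op_ge0_sum => i _.
by rewrite -linearB; exact/Phi_pos/BC.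
Qed.

Let op_le_ip (L : hilbertType R) (B C : 'B(L)) x : operator_le B C ->
  ip (B x) x <= ip (C x) x.
Proof. by move=> BC; rewrite -subr_ge0 -ipBl -opB; exact: op_ge0_ip. Qed.

(** The bounds [m <= A i] are summed through the positive maps, whose values at 1 add up to 1. *)
Let S_ge x : m * nrm x ^+ 2 <= ip (S x) x.
Proof.
have := op_le_ip x (@sum_Phi_le (fun=> m%:C *: (1 : 'B(H))) A _).
under eq_bigr do rewrite linearZ; rewrite -scaler_sumr Phi_one opZ op1 ipZl ipxx; apply.
move=> i; rewrite /operator_le -(poly_operatorC m (A i)) -{1}(poly_operatorX (A i)) -poly_operatorB.
apply: (poly_operator_ge0 (A_sa i) (@A_spec i)) => t /(real_spectrum_itv (@A_spec i)).
by rewrite !hornerE; lra.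
Qed.

Let S_le x : ip (S x) x <= M * nrm x ^+ 2.
Proof.
have := op_le_ip x (@sum_Phi_le A (fun=> M%:C *: (1 : 'B(H))) _).
under [X in _ <= ip (operator_fun X x) x]eq_bigr do rewrite linearZ.
rewrite -scaler_sumr Phi_one opZ op1 ipZl ipxx; apply.
move=> i; rewrite /operator_le -(poly_operatorC M (A i)) -{2}(poly_operatorX (A i)) -poly_operatorB.
apply: (poly_operator_ge0 (A_sa i) (@A_spec i)) => t /(real_spectrum_itv (@A_spec i)).
by rewrite !hornerE; lra.
Qed.

(** The reflection [M + m - t] preserves [[m, M]], so the numerical range of [T] lies there along
    with that of [S]. *)
Let T_spec : spectrum_in T `[m, M].
Proof.
apply: numrange_spectrum => // x; rewrite opB ipBl opZ op1 ipZl ipxx.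
  by have := S_le x; lra.
by have := S_ge x; lra.
Qed.

(** Here [T + S = M + m] and [T ^+ 2 + V = M ^+ 2 + m ^+ 2 - 2 * J], as scalars stand for multiples
    of 1. *)
Let quadratic_sum (a b c : R) x :
  ip (poly_operator (quadratic a b c) T x) x +
    ip ((\sum_(i < n) Phi i (poly_operator (quadratic a b c) (A i))) x) x =
  ((quadratic a b c).[M] + (quadratic a b c).[m]) * nrm x ^+ 2 - 2 * a * ip (J x) x.
Proof.
have -> : \sum_(i < n) Phi i (poly_operator (quadratic a b c) (A i)) =
    a%:C *: V + b%:C *: S + c%:C *: (1 : 'B(K)).
  rewrite -Phi_one !scaler_sumr -!big_split; apply: eq_bigr => i _ /=.
  by rewrite poly_operator_quadratic !linearD !linearZ.
rewrite poly_operator_quadratic !horner_quadratic /J /T !expr2 !(opE, opAD, opAN, opAZ).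
rewrite !(ipDl, ipNl, ipZl) ipxx.
by field.
Qed.

Lemma mercer_gap_ge0 : operator_ge0 J.
Proof.
pose q := quadratic (-1) (M + m) (- (M * m)).
have q0 t : m <= t <= M -> 0 <= q.[t].
  move=> /andP[mt tM]; rewrite horner_quadratic.
  have -> : -1 * t ^+ 2 + (M + m) * t + - (M * m) = (M - t) * (t - m) by ring.
  by rewrite mulr_ge0 ?subr_ge0.
have qmM : q.[M] + q.[m] = 0 by rewrite !horner_quadratic; ring.
apply: ip_op_ge0 => // x.
have := quadratic_sum (-1) (M + m) (- (M * m)) x; rewrite -/q qmM mul0r.
have /(op_ge0_ip x) : operator_ge0 (poly_operator q T).
  by apply: (poly_operator_ge0 sT T_spec) => t /(real_spectrum_itv T_spec); exact: q0.
have /(op_ge0_ip x) : operator_ge0 (\sum_(i < n) Phi i (poly_operator q (A i))).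
  apply: op_ge0_sum => i _; apply: Phi_pos.
  apply: (poly_operator_ge0 (A_sa i) (@A_spec i)) => t /(real_spectrum_itv (@A_spec i)).
  exact: q0.
by lra.
Qed.

Variables (f : R -> R).
Hypothesis f_approx : exists p : nat -> {poly R}, forall e : R, 0 < e ->
  exists N, forall k, (N <= k)%N -> forall t, m <= t <= M -> `|(p k).[t] - f t| <= e.

Let F : 'B(K) := (f M + f m)%:C *: (1 : 'B(K)) - \sum_(i < n) Phi i (cfc f (A i)).

Let A_cfc i : is_cfc f (A i) (cfc f (A i)).
Proof. by have [p hp] := f_approx; exact: cfc_is_cfc hp. Qed.

Let T_cfc : is_cfc f T (cfc f T).
Proof. by have [p hp] := f_approx; exact: cfc_is_cfc hp. Qed.

Let sF : self_adjoint F.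
Proof.
apply: saB; first exact: sa_scalar.
by apply: sa_sum => i _; apply: positive_map_sa => //; exact: sa_is_cfc (A_cfc i).
Qed.

Let sTf : self_adjoint (cfc f T).
Proof. exact: sa_is_cfc T_cfc. Qed.

(** The bound [f <= q] serves at [T] and, through the maps, at each [A i]; the sum of both is
    evaluated by the identity for quadratics. *)
Lemma jensen_mercer_le (gamma b c : R) : (quadratic (gamma / 2) b c).[m] = f m ->
  (quadratic (gamma / 2) b c).[M] = f M ->
  (forall t, m <= t <= M -> f t <= (quadratic (gamma / 2) b c).[t]) ->
  operator_le (cfc f T) (F - gamma%:C *: J).
Proof.
move=> qm qM fq; have := quadratic_sum (gamma / 2) b c; move: (J) sJ => j sj qsum.
apply: ip_op_ge0; first by apply: saB => //; apply: saB => //; exact: saZ.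
move=> x; have := qsum x; rewrite qm qM.
have /(op_le_ip x) := is_cfc_le sT T_spec T_cfc (fun t At => fq t (real_spectrum_itv T_spec At)).
have /(op_le_ip x) := sum_Phi_le (fun i => is_cfc_le (A_sa i) (@A_spec i) (A_cfc i)
  (fun t At => fq t (real_spectrum_itv (@A_spec i) At))).
rewrite /F !opB !(ipDl, ipNl) !opZ !op1 !ipZl ipxx.
by lra.
Qed.

Lemma jensen_mercer_ge (gamma b c : R) : (quadratic (gamma / 2) b c).[m] = f m ->
  (quadratic (gamma / 2) b c).[M] = f M ->
  (forall t, m <= t <= M -> (quadratic (gamma / 2) b c).[t] <= f t) ->
  operator_le (F - gamma%:C *: J) (cfc f T).
Proof.
move=> qm qM qf; have := quadratic_sum (gamma / 2) b c; move: (J) sJ => j sj qsum.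
apply: ip_op_ge0; first by apply: saB => //; apply: saB => //; exact: saZ.
move=> x; have := qsum x; rewrite qm qM.
have /(op_le_ip x) := is_cfc_ge sT T_spec T_cfc (fun t At => qf t (real_spectrum_itv T_spec At)).
have /(op_le_ip x) := sum_Phi_le (fun i => is_cfc_ge (A_sa i) (@A_spec i) (A_cfc i)
  (fun t At => qf t (real_spectrum_itv (@A_spec i) At))).
rewrite /F !opB !(ipDl, ipNl) !opZ !op1 !ipZl ipxx.
by lra.
Qed.

End JensenMercer.

(** * The inequalities for a bounded second derivative *)

Theorem theorem2p1 (R : realType) (H K : hilbertType R) (m M : R) (hmM : m < M)
    (n : nat) (A : 'I_n -> 'B(H)) (Phi : 'I_n -> {linear 'B(H) -> 'B(K)})
    (A_sa : forall i, self_adjoint (A i))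
    (A_spec : forall i, spectrum_in (A i) `[m, M])
    (Phi_pos : forall i, positive_map (Phi i))
    (Phi_one : \sum_(i < n) Phi i 1 = 1)
    (f f' f'' : R -> R) (alpha beta : R)
    (f_cont : {within `[m, M], continuous f})
    (f_diff : has_derivative_on `[m, M] f f')
    (f_diff2 : has_derivative_on `[m, M] f' f'')
    (f''_bounds : forall t, t \in `[m, M]%R -> alpha <= f'' t <= beta) :
  let S : 'B(K) := \sum_(i < n) Phi i (A i) in
  let J : 'B(K) := (M + m)%:C *: S - (M * m)%:C *: (1 : 'B(K))
    - (2^-1)%:C *: (S ^+ 2 + \sum_(i < n) Phi i (A i ^+ 2)) in
  let F : 'B(K) := (f M + f m)%:C *: (1 : 'B(K)) - \sum_(i < n) Phi i (cfc f (A i)) in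
  operator_ge0 J /\
  operator_le (F - beta%:C *: J) (cfc f ((M + m)%:C *: (1 : 'B(K)) - S)) /\
  operator_le (cfc f ((M + m)%:C *: (1 : 'B(K)) - S)) (F - alpha%:C *: J).
Proof.
move=> S J F.
have hf x : m <= x <= M -> derivative_at_on `[m, M] f x (f' x).
  by move=> xmM; apply: has_derivative_on_at => //=; rewrite in_itv.
have hf' x : m <= x <= M -> derivative_at_on `[m, M] f' x (f'' x).
  by move=> xmM; apply: has_derivative_on_at => //=; rewrite in_itv.
have f''a x : m <= x <= M -> alpha <= f'' x.
  by move=> xmM; have := f''_bounds x; rewrite in_itv => /(_ xmM)/andP[].
have f''b x : m <= x <= M -> f'' x <= beta.
  by move=> xmM; have := f''_bounds x; rewrite in_itv => /(_ xmM)/andP[].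
have f_approx : exists p : nat -> {poly R}, forall e : R, 0 < e ->
    exists N, forall k, (N <= k)%N -> forall t, m <= t <= M -> `|(p k).[t] - f t| <= e.
  (* Whatever the signs of [alpha] and [beta], this constant bounds the absolute value of [f'']. *)
  apply: (@bernstein_approx _ m M (`|alpha| + `|beta|) f f' hmM).
  apply: (taylor_le hf hf') => x xmM.
  have := f''a x xmM; have := f''b x xmM; have := ler_norm (- alpha); have := ler_norm beta.
  by have := normr_ge0 alpha; have := normr_ge0 beta; rewrite normrN ler_norml; lra.
have [ba [ca [qma qMa fqa]]] := convex_chord_le hmM hf hf' f''a.
have [bb [cb [qmb qMb fqb]]] := concave_chord_ge hmM hf hf' f''b.
split; first exact: mercer_gap_ge0.
by split; [exact: jensen_mercer_ge fqb | exact: jensen_mercer_le fqa].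
Qed.
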